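(* Let $1\le k\le n$ and $\mu=(1^{k-1},n-k+1)$. The ideal $J_\mu=\mathbf{H}_\mu^\perp$ is the ideal of $\mathbf{Q}[\bar x,\bar y]$ generated by (i) $\Lambda[\bar x]^+$ and $\Lambda[\bar y]^+$; (ii) the monomials $x_{i_1}\cdots x_{i_k}$ ($1\le i_1<\cdots<i_k\le n$) and $y_{i_1}\cdots y_{i_{n-k+1}}$ ($1\le i_1<\cdots<i_{n-k+1}\le n$); and (iii) the monomials $x_iy_i$ ($1\le i\le n$).
   Context: $\mathbf{Q}[\bar x,\bar y]=\mathbf{Q}[x_1,\dots,x_n,y_1,\dots,y_n]$. $\Lambda[\bar x]^+$ (resp. $\Lambda[\bar y]^+$) is the set of symmetric polynomials in $x_1,\dots,x_n$ (resp. in $y_1,\dots,y_n$) without constant term. For the hook shape $\mu=(1^{k-1},n-k+1)$ let $\Delta_\mu$ be the determinant of the $n\times n$ matrix whose $i$-th row is $(1,y_i,y_i^2,\dots,y_i^{n-k},x_i,x_i^2,\dots,x_i^{k-1})$. Let $\mathbf{H}_\mu$ be the $\mathbf{Q}$-span of all partial derivatives (of all orders, including order $0$) of $\Delta_\mu$ with respect to the $x_i$ and $y_i$. Let $\langle f,g\rangle$ be the constant term of $f(\partial_{x_1},\dots,\partial_{x_n};\partial_{y_1},\dots,\partial_{y_n})\,g(\bar x;\bar y)$, and $J_\mu=\mathbf{H}_\mu^\perp=\{f\in\mathbf{Q}[\bar x,\bar y]:\langle f,g\rangle=0\ \forall g\in\mathbf{H}_\mu\}$. *)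

(* Defs.v *)
From HB Require Import structures.
From mathcomp Require Import all_boot all_order all_algebra.
From mathcomp Require Import mpoly.

Set Implicit Arguments.
Unset Strict Implicit.
Unset Printing Implicit Defensive.

Import GRing.Theory.
Local Open Scope ring_scope.

Definition lin_span (K : fieldType) (V : lmodType K) (G : V -> Prop) (v : V) :
    Prop :=
  exists2 s : seq (K * V),
    (forall p, p \in s -> G p.2) & v = \sum_(p <- s) p.1 *: p.2.

Definition ideal_gen (R : comNzRingType) (G : R -> Prop) (f : R) : Prop :=
  exists2 s : seq (R * R),
    (forall p, p \in s -> G p.2) & f = \sum_(p <- s) p.1 * p.2.

(* Q[x_1, ..., x_n, y_1, ..., y_n]: the first n of the n + n indeterminates
   are the x_i, the last n are the y_i. *)
Notation Qxy n := {mpoly rat[n + n]}.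

Definition xvar (n : nat) (i : 'I_n) : Qxy n := 'X_(lshift n i).
Definition yvar (n : nat) (i : 'I_n) : Qxy n := 'X_(rshift n i).

Definition sym_plus_x (n : nat) (f : Qxy n) : Prop :=
  exists p : {mpoly rat[n]},
    [/\ p \is symmetric, p@_0 = 0 & f = p \mPo [tuple xvar i | i < n]].

Definition sym_plus_y (n : nat) (f : Qxy n) : Prop :=
  exists p : {mpoly rat[n]},
    [/\ p \is symmetric, p@_0 = 0 & f = p \mPo [tuple yvar i | i < n]].

(* For 1 <= k <= n, row i is (1, y_i, ..., y_i^(n-k), x_i, ..., x_i^(k-1)):
   column j (counted from 0) is y_i^j if j <= n-k, and x_i^(j-(n-k)) beyond. *)
Definition hook_mx (n k : nat) : 'M[Qxy n]_n :=
  \matrix_(i, j) if (j <= n - k)%N then yvar i ^+ j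
                 else xvar i ^+ (j - (n - k)).

Definition Delta (n k : nat) : Qxy n := \det (hook_mx n k).

Definition H_mu (n k : nat) : Qxy n -> Prop :=
  lin_span (fun g => exists m : 'X_{1..n + n}, g = mderivm m (Delta n k)).

(* f(d/dx; d/dy) g *)
Definition diff_op (N : nat) (f g : {mpoly rat[N]}) : {mpoly rat[N]} :=
  \sum_(m <- msupp f) f@_m *: mderivm m g.

Definition pairing (N : nat) (f g : {mpoly rat[N]}) : rat := (diff_op f g)@_0.

Definition J_mu (n k : nat) (f : Qxy n) : Prop :=
  forall g, H_mu k g -> pairing f g = 0.

Variant hook_gen (n k : nat) : Qxy n -> Prop :=
| HookSymX f of sym_plus_x f : hook_gen k f
| HookSymY f of sym_plus_y f : hook_gen k f
| HookMonX (A : {set 'I_n}) of #|A| = k :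
    hook_gen k (\prod_(i in A) xvar i)
| HookMonY (A : {set 'I_n}) of #|A| = (n - k + 1)%N :
    hook_gen k (\prod_(i in A) yvar i)
| HookMonXY (i : 'I_n) : hook_gen k (xvar i * yvar i).

(* Main.v *)
Require Import Defs.
From mathcomp Require Import all_boot all_order all_algebra all_fingroup.
From mathcomp Require Import mpoly.
From mathcomp Require Import zify ring.

(** Let q = n - k.  Reordering its columns, the determinant is, up to sign, the
    alternating sum over the permutations s of the monomials [hook_mon q s], in
    which position i carries x_i^(s i - q) if s i >= q and y_i^(q - s i)
    otherwise: its signed exponents are the integers s i - q.  The products of
    factorials of the exponents are the same for all these monomials, so f lies
    in J_mu exactly when the alternating sum [alt_coef] of the coefficients of
    f * 'X_[m] on the monomials [hook_mon q s] vanishes for all m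
    ([J_mu_alt_coef]).

    The generators lie in J_mu.  The monomial ones divide no [hook_mon q s].  For
    a symmetric p in one set of variables, p * 'X_[m] is killed by antisymmetry
    when two positions of m carry the same exponents; otherwise the exponents of
    m are too large for a monomial of p of positive degree to complete them into
    a [hook_mon q s] ([alt_coef_sym]).

    Conversely, give position i of a monomial with signed exponents c_i the
    weight n * c_i - i.  These weights are distinct: they sort the positions by
    signed exponent, ties being broken by position.  Call the sum of their
    squares the energy.  When two consecutive sorted weights differ by more than
    n, the positions above the gap (if their exponents are positive) or below it
    (if they are negative) form a set S whose variables can be split off, and
    subtracting a multiple of the elementary symmetric polynomial of degree
    #|S| replaces the monomial by monomials of smaller energy ([straightening],
    [energy_exchange]): this is the straightening of Garsia and Stanton for
    descent monomials, carried over to signed exponents.  Hence, modulo the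
    ideal, every polynomial is a combination of monomials that have all gaps
    below n and miss the monomial generators ([spanned_reduced]).

    Such a reduced monomial m, sorted by s, divides [hook_mon q s]
    ([reduced_exists]).  Its cofactor detects it: by the rearrangement
    inequality, any other monomial d whose product with that cofactor is some
    [hook_mon q t] has larger energy than m ([energy_hook_complement]).  In a
    nonzero combination of reduced monomials, the cofactor of a term of maximal
    energy sees that term alone, so the combination is not in J_mu
    ([reduced_J_mu_eq0]).  A polynomial of J_mu is congruent to such a
    combination, which also lies in J_mu, hence is zero. *)

Set Implicit Arguments.
Unset Strict Implicit.
Unset Printing Implicit Defensive.

Import Order.TTheory GRing.Theory Num.Theory.
Local Open Scope ring_scope.

(** * Ideals given by generators *)

Section IdealGen.
Variables (R : comNzRingType) (G : R -> Prop).

Lemma ideal_gen_mem g : G g -> ideal_gen G g.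
Proof.
move=> Gg; exists [:: (1, g)]; last by rewrite big_seq1 mul1r.
by move=> p; rewrite inE => /eqP->.
Qed.

Lemma ideal_gen0 : ideal_gen G 0.
Proof. by exists [::]; rewrite ?big_nil. Qed.

Lemma ideal_genD f g : ideal_gen G f -> ideal_gen G g -> ideal_gen G (f + g).
Proof.
case=> [s sG ->] [t tG ->]; exists (s ++ t); last by rewrite big_cat.
by move=> p; rewrite mem_cat => /orP[/sG|/tG].
Qed.

Lemma ideal_genM f g : ideal_gen G g -> ideal_gen G (f * g).
Proof.
case=> s sG ->; exists [seq (f * p.1, p.2) | p <- s].
  by move=> _ /mapP[p /sG Gp ->].
by rewrite big_map mulr_sumr; apply: eq_bigr => p _; rewrite mulrA.
Qed.

End IdealGen.

(** * Extremal subsets and permutations *)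

Section Extremal.
Variable R : realDomainType.

(** Exchanging [S :\: T] for the equinumerous [T :\: S] only loses: the least
    value on the former exceeds every value on the latter. *)
Lemma ltr_sum_topset (I : finType) (g : I -> R) (S T : {set I}) :
  #|T| = #|S| -> T != S -> {in S & ~: S, forall i j, g j < g i} ->
  \sum_(i in T) g i < \sum_(i in S) g i.
Proof.
move=> cardTS neTS topS.
have cardD : #|T :\: S| = #|S :\: T|.
  by have := cardsID S T; have := cardsID T S; rewrite setIC cardTS; lia.
have [i0 i0D] : exists i, i \in S :\: T.
  apply/set0Pn; rewrite setD_eq0; apply: contra neTS => sST.
  by rewrite eq_sym eqEcard sST cardTS leqnn.
rewrite (big_setID S) [ltRHS](big_setID T) /= setIC ltrD2l.
have [i1 i1D i1min] := arg_minP g i0D.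
have /setDP[i1S _] := i1D.
have ltT j : j \in T :\: S -> g j < g i1.
  by case/setDP=> _ jS; apply: topS; rewrite ?inE.
apply: (@lt_le_trans _ _ (\sum_(i in T :\: S) g i1)).
  have [j0 j0D] : exists j, j \in T :\: S.
    by apply/set0Pn; rewrite -card_gt0 cardD card_gt0; apply/set0Pn; exists i0.
  rewrite [ltLHS](bigD1 j0) //= [ltRHS](bigD1 j0) //= ltr_leD ?ltT //.
  by apply: ler_sum => j /andP[/ltT/ltW].
rewrite sumr_const cardD -sumr_const.
by apply: ler_sum => j /i1min.
Qed.

Lemma perm_layers n (s : 'S_n) (i : 'I_n) :
  (s i)%:R = \sum_(v < n) (v < s i)%N%:R :> R.
Proof.
rewrite -natr_sum; congr _%:R; rewrite -[LHS]card_ord -sum1_card.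
rewrite (big_ord_widen n (fun=> 1%N)) ?[LHS]big_mkcond; last exact: ltnW.
by apply: eq_bigr => v _; case: ltnP.
Qed.

(** Rearrangement inequality, strict form.  A permutation is the sum of the
    indicators of its superlevel sets, and those of [s] minimise the sum of [a]
    among all subsets of their size. *)
Lemma ltr_rearrangement n (a : 'I_n -> R) (s t : 'S_n) :
  (forall i j, (s i < s j)%N -> a j < a i) -> t != s ->
  \sum_i a i * (s i)%:R < \sum_i a i * (t i)%:R.
Proof.
move=> a_decr neq_ts; pose L (u : 'S_n) v := [set i | (v < u i)%N].
have layers (u : 'S_n) : \sum_i a i * (u i)%:R = \sum_(v < n) \sum_(i in L u v) a i.
  under [RHS]eq_bigr do rewrite big_mkcond.
  rewrite exchange_big; apply: eq_bigr => i _; rewrite perm_layers mulr_sumr.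
  by apply: eq_bigr => v _; rewrite inE; case: ltnP; rewrite ?mulr1 ?mulr0.
have cardL v : #|L t v| = #|L s v|.
  have cardLu (u : 'S_n) : #|L u v| = #|[set j : 'I_n | (v < j)%N]|.
    rewrite -(card_imset _ (@perm_inj _ u)); apply: eq_card => j.
    apply/imsetP/idP => [[i]|]; rewrite !inE; first by move=> ? ->.
    by move=> lt_vj; exists ((u^-1)%g j); rewrite ?inE permKV.
  by rewrite !cardLu.
have ltL v : L t v != L s v ->
    \sum_(i in L s v) a i < \sum_(i in L t v) a i.
  move=> neL; rewrite -ltrN2 -!sumrN; apply: ltr_sum_topset => // i j.
  rewrite !inE -leqNgt ltrN2 => lt_vi le_jv; apply: a_decr.
  exact: leq_ltn_trans le_jv lt_vi.
rewrite !layers; have [v neL] : exists v : 'I_n, L t v != L s v.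
  apply/existsP; apply: contraNT neq_ts; rewrite negb_exists => /forallP eqL.
  apply/eqP/permP => i; apply: ord_inj; apply/eqP.
  rewrite -(eqr_nat R) !perm_layers; apply/eqP; apply: eq_bigr => v _.
  by have /setP/(_ i) := eqP (negbNE (eqL v)); rewrite !inE => ->.
rewrite [ltLHS](bigD1 v) // [ltRHS](bigD1 v) //= ltr_leD ?ltL //.
by apply: ler_sum => u _; have [->|/ltL/ltW] := eqVneq (L t u) (L s u).
Qed.

End Extremal.

(** The permutation sends each index to its rank. *)
Lemma perm_sorting (R : realDomainType) n (g : 'I_n -> R) : injective g ->
  exists s : 'S_n, forall i j, (s i < s j)%N = (g i < g j).
Proof.
move=> g_inj; pose below i := [set j | g j < g i].
have rank_lt i : (#|below i| < n)%N.
  rewrite -[X in (_ < X)%N]card_ord -cardsT proper_card // properE subsetT.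
  by apply/subsetPn; exists i; rewrite ?inE ?ltxx.
have rank_homo i j : g i < g j -> (#|below i| < #|below j|)%N.
  move=> lt_ij; apply: proper_card; rewrite properE; apply/andP; split.
    by apply/subsetP=> l; rewrite !inE => /lt_trans; apply.
  by apply/subsetPn; exists i; rewrite ?inE ?ltxx.
have rankE i j : (#|below i| < #|below j|)%N = (g i < g j).
  apply/idP/idP => [|/rank_homo//].
  apply: contraTT; rewrite -leNgt -leqNgt le_eqVlt.
  by case/orP=> [/eqP/g_inj-> //|/rank_homo/ltnW].
have rank_inj : injective (fun i => Ordinal (rank_lt i)).
  move=> i j [eq_ij]; apply: g_inj.
  by have := rankE i j; have := rankE j i; rewrite eq_ij ltnn; case: ltgtP.
by exists (perm rank_inj) => i j; rewrite !permE rankE.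
Qed.

Lemma card_perm_geq n (s : 'S_n) v : #|[set i | (v <= s i)%N]| = (n - v)%N.
Proof.
rewrite -(card_imset _ (@perm_inj _ s)).
have -> : s @: [set i | (v <= s i)%N] = [set j : 'I_n | (v <= j)%N].
  apply/setP=> j; apply/imsetP/idP => [[i]|]; rewrite !inE; first by move=> ? ->.
  by move=> le_vj; exists ((s^-1)%g j); rewrite ?inE permKV.
rewrite cardsE -sum1_card.
by rewrite -(@big_geq_mkord _ _ _ v n predT (fun=> 1%N)) sum_nat_const_nat muln1.
Qed.

Lemma subset_of_card (T : finType) (S : {set T}) r : (r <= #|S|)%N ->
  exists2 A : {set T}, A \subset S & #|A| = r.
Proof.
move=> le_rS; exists [set x in take r (enum S)].
  by apply/subsetP => x; rewrite inE => /mem_take; rewrite mem_enum.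
rewrite cardsE (card_uniqP _) ?take_uniq ?enum_uniq //.
by rewrite size_takel -?cardE.
Qed.

(** * Signed exponents, weights and energy *)

Section Monomials.
Variable n : nat.
Implicit Types (m : 'X_{1..n + n}) (A : {set 'I_n}) (b : bool).

(** The two blocks of variables are treated together, [side false] indexing the
    x_i and [side true] the y_i; the sign (-1) ^+ b turns statements about large
    weights on the x side into statements about small weights on the y side. *)
Definition side b (i : 'I_n) : 'I_(n + n) := if b then rshift n i else lshift n i.

Lemma side_eq b b' i j : (side b i == side b' j) = (b == b') && (i == j).
Proof.
by rewrite /side; case: b; case: b';
  rewrite ?eq_lshift ?eq_rshift ?eq_lrshift ?eq_rlshift.
Qed.

Definition side_mon b A : 'X_{1..n + n} := (\sum_(i in A) U_(side b i))%MM.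

Lemma side_monE b A b' i : side_mon b A (side b' i) = ((b == b') && (i \in A)).
Proof.
rewrite /side_mon mnm_sumE big_mkcond (bigD1 i) //= big1 => [|j neq_ji].
  by rewrite mnm1E side_eq eqxx andbT addn0; case: (i \in A); rewrite ?andbF ?andbT.
by case: (j \in A); rewrite // mnm1E side_eq (negPf neq_ji) andbF.
Qed.

Lemma side_onto l : exists b i, l = side b i.
Proof.
by case: (fintype.splitP l) => i l_i; [exists false, i|exists true, i];
  apply: val_inj.
Qed.

Definition side_supp m b := [set i : 'I_n | (0 < m (side b i))%N].

Lemma side_mon_le m b A : A \subset side_supp m b -> (side_mon b A <= m)%MM.
Proof.
move/subsetP => sAm; apply/mnm_lepP => l; have [b' [i ->]] := side_onto l.
rewrite side_monE; case: (b =P b') => //= <-.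
by case: (boolP (i \in A)) => // /sAm; rewrite inE.
Qed.

Definition signed_exp m (i : 'I_n) : int :=
  (m (side false i))%:Z - (m (side true i))%:Z.

(** As |i - j| < n, the term - i only breaks the ties between equal signed
    exponents; adding a variable at position i moves its weight by n. *)
Definition weight m (i : 'I_n) : int := n%:Z * signed_exp m i - i%:Z.

(** The squares make the energy strictly convex: among the monomials obtained
    by multiplying a given one by e distinct variables of one side, the energy
    is largest when the e positions of extreme weight are chosen. *)
Definition energy m : int := \sum_i weight m i ^+ 2.

Lemma signed_exp_homo m i j :
  weight m i <= weight m j -> signed_exp m i <= signed_exp m j.
Proof.
rewrite /weight => le_ij; rewrite leNgt; apply/negP => lt_ji.
have [lt_in lt_jn] := (ltn_ord i, ltn_ord j).
have: n%:Z * (signed_exp m j + 1) <= n%:Z * signed_exp m i.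
  by apply: ler_wpM2l => //; lia.
by rewrite mulrDr; lia.
Qed.

Lemma weight_inj m : injective (weight m).
Proof.
move=> i j eq_ij; apply: ord_inj; have := eq_ij; rewrite /weight.
have -> : signed_exp m i = signed_exp m j.
  by apply: le_anti; rewrite !signed_exp_homo ?eq_ij.
by lia.
Qed.

Lemma weight_addmon m b A i :
  weight (m + side_mon b A)%MM i =
  weight m i + (-1) ^+ b * n%:Z * (i \in A)%:R.
Proof.
rewrite /weight /signed_exp !mnmDE !side_monE.
by case: b; case: (i \in A) => /=; rewrite ?expr1 ?expr0; ring.
Qed.

Lemma energy_addmon m b A :
  energy (m + side_mon b A)%MM =
  energy m + (n * n)%:Z *+ #|A|
    + 2%:R * n%:Z * \sum_(i in A) (-1) ^+ b * weight m i.
Proof.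
rewrite /energy (eq_bigr (fun i => weight m i ^+ 2
  + (if i \in A then (n * n)%:Z + 2%:R * n%:Z * ((-1) ^+ b * weight m i) else 0))).
  by rewrite big_split -big_mkcond big_split /= sumr_const -mulr_sumr addrA.
move=> i _; rewrite weight_addmon.
by case: b; case: (i \in A) => /=; rewrite ?expr1 ?expr0; ring.
Qed.

(** The last condition says that [S] is still strictly extremal for the weights
    of the monomial that remains once the variables of [S] on side [b] have been
    split off, since this brings their weights n closer to the others. *)
Definition detachable m b (S : {set 'I_n}) : bool :=
  [&& S != set0, [forall i in S, (0 < m (side b i))%N] &
      [forall i in S, [forall j in ~: S,
        (-1) ^+ b * weight m j < (-1) ^+ b * weight m i - n%:Z]]].

(** Both monomials are products of the same cofactor with #|S| variables, so by
    [energy_addmon] their energies differ by a multiple of the difference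
    between the sums over [T] and over [S] of the weights of the cofactor, for
    which [S] is the extremal set. *)
Lemma energy_exchange m b (S T : {set 'I_n}) :
  detachable m b S -> #|T| = #|S| -> T != S ->
  energy (m - side_mon b S + side_mon b T)%MM < energy m.
Proof.
case/and3P=> S0 /forall_inP Spos /forall_inP Stop cardTS neqTS.
have leSm : (side_mon b S <= m)%MM.
  by apply/side_mon_le/subsetP => i /Spos; rewrite inE.
rewrite -[ltRHS](congr1 energy (submK leSm)) !energy_addmon cardTS.
have n_gt0 : (0 < n)%N by have [i _] := set0Pn _ S0; exact: leq_ltn_trans (ltn_ord i).
rewrite ltrD2l ltr_pM2l; last by rewrite mulr_gt0.
apply: ltr_sum_topset => // i j iS jS.
move/(_ _ iS): Stop => /forall_inP/(_ _ jS).
rewrite -{1 2}(submK leSm) !weight_addmon iS.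
have /negPf -> : j \notin S by move: jS; rewrite inE.
by clear; case: b => /=; rewrite ?expr1 ?expr0; lia.
Qed.

End Monomials.

Arguments side : simpl never.

(** * Reduced monomials and their cofactors *)

Section Reduced.
Variables n q : nat.
Implicit Types (m d : 'X_{1..n + n}) (s t : 'S_n).

(** One of the truncated differences always vanishes. *)
Definition hook_mon s : 'X_{1..n + n} :=
  [multinom match fintype.split l with
            | inl i => (s i - q)%N
            | inr i => (q - s i)%N
            end | l < n + n].

Lemma hook_monE s b i :
  hook_mon s (side b i) = if b then (q - s i)%N else (s i - q)%N.
Proof.
by rewrite mnmE; case: b; rewrite /side ?(unsplitK (inl i)) ?(unsplitK (inr i)).
Qed.

(** Up to the constant n * q, this is the weight of [m] minus n times the signed
    exponent of [hook_mon s]. *)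
Definition residual m s (i : 'I_n) : int := weight m i - n%:Z * (s i)%:Z.

(** When [s] sorts the weights of [m], the residuals decrease along [s] exactly
    when consecutive sorted weights differ by less than n. *)
Definition reduced_by m s : Prop :=
  (m <= hook_mon s)%MM /\
  (forall i j, (s i < s j)%N -> residual m s j < residual m s i).

(** The weights of [m] and of [d] are, up to a common constant, a + n * s and
    a + n * t, where a is the residual of [m].  Their sums of squares differ only
    through the cross terms, and since a decreases along [s] the rearrangement
    inequality makes the cross term of [s] the smallest. *)
Lemma energy_hook_complement m d s t : reduced_by m s ->
  (d + (hook_mon s - m))%MM = hook_mon t -> t != s -> energy m < energy d.
Proof.
case=> le_ms res_decr eq_t neq_ts.
have weight_d i : weight d i = weight m i + n%:Z * ((t i)%:Z - (s i)%:Z).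
  have eq_side b : (d (side b i) + (hook_mon s (side b i) - m (side b i)) =
                    hook_mon t (side b i))%N by rewrite -eq_t mnmDE mnmBE.
  have eq_exp : signed_exp d i = signed_exp m i + ((t i)%:Z - (s i)%:Z).
    have := eq_side true; have := eq_side false.
    have := mnm_lepP le_ms (side true i); have := mnm_lepP le_ms (side false i).
    by rewrite /signed_exp !hook_monE; lia.
  by rewrite /weight eq_exp; ring.
have sq_sum (u : 'S_n) : \sum_i ((u i)%:Z) ^+ 2 = \sum_(i < n) i%:Z ^+ 2.
  by rewrite [RHS](reindex_inj (@perm_inj _ u)).
have expand (u : 'S_n) : \sum_i (residual m s i + n%:Z * (u i)%:Z) ^+ 2 =
    \sum_i residual m s i ^+ 2 + n%:Z ^+ 2 * \sum_(i < n) i%:Z ^+ 2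
      + 2%:R * n%:Z * \sum_i residual m s i * (u i)%:R.
  rewrite -(sq_sum u) !mulr_sumr -!big_split; apply: eq_bigr => i _ /=.
  by rewrite -natz; ring.
have n_gt0 : (0 < n)%N.
  case: n s t neq_ts {le_ms res_decr eq_t weight_d sq_sum expand} => // s t.
  by case/eqP; apply/permP => -[].
have <- : \sum_i (residual m s i + n%:Z * (s i)%:Z) ^+ 2 = energy m.
  by apply: eq_bigr => i _; rewrite subrK.
have <- : \sum_i (residual m s i + n%:Z * (t i)%:Z) ^+ 2 = energy d.
  by apply: eq_bigr => i _; rewrite weight_d /residual; congr (_ ^+ 2); ring.
rewrite !expand ltrD2l ltr_pM2l; last by rewrite mulr_gt0.
exact: ltr_rearrangement.
Qed.

(** Across a gap of at least n the signed exponents strictly increase, so either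
    all those above are positive or all those below are negative; accordingly
    the positions above are detachable on the x side, or the positions below on
    the y side. *)
Lemma weight_gap_lt m s : (forall b S, ~~ detachable m b S) ->
  (forall i j, (s i < s j)%N = (weight m i < weight m j)) ->
  forall i j, s j = (s i).+1 :> nat -> weight m j < weight m i + n%:Z.
Proof.
move=> nodetach sortE i j sij; rewrite ltNge; apply/negP => gap.
have s_homo l l' : (s l <= s l')%N -> weight m l <= weight m l'.
  by rewrite leqNgt sortE -leNgt.
have [lt_in lt_jn] := (ltn_ord i, ltn_ord j).
have neq_ij : i <> j :> nat by move/ord_inj=> eq_ij; move: sij; rewrite eq_ij; lia.
have lt_exp : signed_exp m i < signed_exp m j.
  rewrite ltNge; apply/negP => /(ler_wpM2l (ler0n int n)); rewrite !natz.
  by move: gap; rewrite /weight; lia.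
have {}gap : weight m i + n%:Z < weight m j.
  (* A gap of exactly n would force n to divide i - j. *)
  rewrite lt_neqAle gap andbT; apply/eqP; rewrite /weight.
  move: (signed_exp m i) (signed_exp m j) lt_exp => c c' lt_cc' eq_gap.
  have [eq_exp|lt_exp] : c' = c + 1 \/ c + 1 + 1 <= c' by lia.
    by apply: neq_ij; move: eq_gap; rewrite eq_exp mulrDr mulr1; lia.
  by have /(ler_wpM2l (ler0n int n)) := lt_exp; rewrite !mulrDr mulr1 !natz; lia.
have exp_homo l l' : (s l <= s l')%N -> signed_exp m l <= signed_exp m l'.
  by move=> le_ll'; rewrite signed_exp_homo ?s_homo.
have [exp_j|exp_i] : 1 <= signed_exp m j \/ signed_exp m i <= -1 by lia.
  apply: (negP (nodetach false [set l | (s j <= s l)%N])).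
  apply/and3P; split; first by apply/set0Pn; exists j; rewrite inE.
    apply/forall_inP => l; rewrite inE => /exp_homo.
    by rewrite [signed_exp m l]/signed_exp; lia.
  apply/forall_inP => l; rewrite inE => /s_homo le_jl.
  apply/forall_inP => l'; rewrite !inE -ltnNge sij ltnS => /s_homo le_l'i.
  by rewrite /= expr0 !mul1r; lia.
apply: (negP (nodetach true [set l | (s l <= s i)%N])).
apply/and3P; split; first by apply/set0Pn; exists i; rewrite inE.
  apply/forall_inP => l; rewrite inE => /exp_homo.
  by rewrite [signed_exp m l]/signed_exp; lia.
apply/forall_inP => l; rewrite inE => /s_homo le_li.
apply/forall_inP => l'; rewrite !inE -ltnNge -sij => /s_homo le_jl'.
by rewrite /= expr1 !mulN1r; lia.
Qed.

Lemma residual_decr m s :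
  (forall i j, s j = (s i).+1 :> nat -> weight m j < weight m i + n%:Z) ->
  forall i j, (s i < s j)%N -> residual m s j < residual m s i.
Proof.
move=> gap_lt i j /subnKC; move: (_ - _)%N => e; elim: e j => [|e IHe] j sij.
  have := gap_lt i j; rewrite /residual -sij addn0 => /(_ erefl).
  by rewrite -addn1 PoszD mulrDr mulr1; lia.
have lt_en : ((s i).+1 + e < n)%N by apply: leq_ltn_trans (ltn_ord (s j)); lia.
pose l := (s^-1)%g (Ordinal lt_en).
have sl : s l = ((s i).+1 + e)%N :> nat by rewrite permKV.
apply: lt_trans (IHe l (esym sl)).
have := gap_lt l j; rewrite -sij sl addnS => /(_ erefl).
by rewrite /residual -sij sl addnS -[in n%:Z * (_.+1)%:Z]addn1 PoszD mulrDr mulr1; lia.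
Qed.

(** There are fewer than n - q positive and at most q negative signed exponents,
    so the position of rank q has signed exponent 0, as in [hook_mon].  Moving
    away from it along the sorted order, the monotone residuals keep the signed
    exponents of [m] between 0 and those of [hook_mon]. *)
Lemma reduced_exists m : (q < n)%N ->
  [disjoint side_supp m false & side_supp m true] ->
  (#|side_supp m false| < n - q)%N -> (#|side_supp m true| <= q)%N ->
  (forall b S, ~~ detachable m b S) -> exists s, reduced_by m s.
Proof.
move=> lt_qn disj suppX suppY nodetach.
have [s sortE] := perm_sorting (@weight_inj n m); exists s.
have decr := residual_decr (weight_gap_lt nodetach sortE); split=> //.
have exp_homo i j : (s i <= s j)%N -> signed_exp m i <= signed_exp m j.
  by rewrite leqNgt sortE -leNgt; apply: signed_exp_homo.
have disjE i : (m (side false i) == 0 :> nat) || (m (side true i) == 0 :> nat).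
  case: posnP => [//|m_gt0]; rewrite /= eqn0Ngt.
  by have := disjointFr disj (x := i); rewrite !inE => /(_ m_gt0) ->.
have rankX i : 0 < signed_exp m i -> (q < s i)%N.
  move=> exp_i; have: (n - s i <= #|side_supp m false|)%N.
    rewrite -(card_perm_geq s); apply: subset_leq_card; apply/subsetP => l.
    by rewrite !inE => /exp_homo; rewrite [signed_exp m l]/signed_exp; lia.
  by have := ltn_ord (s i); lia.
have rankY i : signed_exp m i < 0 -> (s i < q)%N.
  move=> exp_i; have: (n - (n - (s i).+1) <= #|side_supp m true|)%N.
    have <- : #|~: [set l | (s i < s l)%N]| = (n - (n - (s i).+1))%N.
      by rewrite cardsCs setCK card_ord card_perm_geq.
    apply: subset_leq_card; apply/subsetP => l.
    rewrite !inE -leqNgt => /exp_homo; rewrite [signed_exp m l]/signed_exp; lia.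
  by have := ltn_ord (s i); lia.
pose i0 := (s^-1)%g (Ordinal lt_qn); have si0 : s i0 = q :> nat by rewrite permKV.
have exp0 : signed_exp m i0 = 0.
  by have := rankX i0; have := rankY i0; rewrite si0 ltnn; lia.
apply/mnm_lepP => l; have [b [i ->]] := side_onto l; rewrite hook_monE.
have [lt_in lt_i0n] := (ltn_ord i, ltn_ord i0).
case: (posnP (m (side b i))) => [->//|m_gt0].
case: b m_gt0 => m_gt0.
  have mE : signed_exp m i = - (m (side true i))%:Z.
    by have := disjE i; rewrite /signed_exp; lia.
  have lt_iq : (s i < q)%N by apply: rankY; lia.
  have := decr i i0; rewrite si0 /residual /weight exp0 mE => /(_ lt_iq) lt_res.
  rewrite leqNgt; apply/negP => gt_m.
  have: n%:Z * (q%:Z - (s i)%:Z + 1) <= n%:Z * (m (side true i))%:Z.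
    by apply: ler_wpM2l; lia.
  by rewrite mulrDr mulrBr; lia.
have mE : signed_exp m i = (m (side false i))%:Z.
  by have := disjE i; rewrite /signed_exp; lia.
have lt_qi : (q < s i)%N by apply: rankX; lia.
have := decr i0 i; rewrite si0 /residual /weight exp0 mE => /(_ lt_qi) lt_res.
rewrite leqNgt; apply/negP => gt_m.
have: n%:Z * ((s i)%:Z - q%:Z + 1) <= n%:Z * (m (side false i))%:Z.
  by apply: ler_wpM2l; lia.
by rewrite mulrDr mulrBr; lia.
Qed.

End Reduced.

(** * Straightening modulo the hook ideal *)

Lemma side_monX n b (A : {set 'I_n}) :
  'X_[side_mon b A] = \prod_(i in A) (if b then yvar i else xvar i).
Proof. by rewrite -mprodXE; apply: eq_bigr => i _; case: b. Qed.

Section Straightening.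
Variables n k : nat.
Hypothesis k_gt0 : (0 < k)%N.
Hypothesis k_le_n : (k <= n)%N.
Local Notation q := (n - k)%N.
Local Notation hook_ideal := (ideal_gen (hook_gen (n := n) k)).
Implicit Types (m d : 'X_{1..n + n}) (f g r : Qxy n).

Lemma hook_ideal_esym b e : (0 < e)%N ->
  hook_ideal (\sum_(A : {set 'I_n} | #|A| == e) 'X_[side_mon b A]).
Proof.
move=> e_gt0; apply: ideal_gen_mem.
have coef0 : (mesym n rat e)@_0 = 0.
  by rewrite mcoeff_mesym /mechar mdeg0 eq_sym (gtn_eqF e_gt0).
case: b; [apply: HookSymY | apply: HookSymX];
  exists (mesym n rat e); rewrite mesym_sym coef0; split=> //;
  rewrite raddf_sum; apply: eq_bigr => A _; rewrite side_monX /= rmorph_prod;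
  by apply: eq_bigr => i _; rewrite /= comp_mpolyXU -tnth_nth tnth_mktuple.
Qed.

Lemma hook_ideal_mnm_le a m :
  hook_ideal 'X_[a] -> (a <= m)%MM -> hook_ideal 'X_[m].
Proof. by move=> Ia /submK <-; rewrite mpolyXD; apply: ideal_genM. Qed.

Lemma hook_ideal_mixed m (i : 'I_n) :
  i \in side_supp m false -> i \in side_supp m true -> hook_ideal 'X_[m].
Proof.
rewrite !inE => x_i y_i.
apply: (@hook_ideal_mnm_le (U_(side false i) + U_(side true i))).
  by rewrite mpolyXD; apply/ideal_gen_mem/HookMonXY.
apply/mnm_lepP => l; have [b [j ->]] := side_onto l.
rewrite mnmDE !mnm1E !side_eq; case: (i =P j) => [<-|_]; last by rewrite !andbF.
by case: b.
Qed.

Lemma hook_ideal_wide m b :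
  ((if b then q.+1 else k) <= #|side_supp m b|)%N -> hook_ideal 'X_[m].
Proof.
case/subset_of_card => A sAm cardA.
apply: hook_ideal_mnm_le (side_mon_le sAm); rewrite side_monX.
apply: ideal_gen_mem; case: b cardA {sAm} => cardA; last exact: HookMonX.
by apply: HookMonY; rewrite cardA addn1.
Qed.

Definition spanned (P : 'X_{1..n + n} -> Prop) f : Prop :=
  exists2 r, (forall d, d \in msupp r -> P d) & hook_ideal (f - r).

Lemma spanned_mod P f g : hook_ideal (f - g) -> spanned P g -> spanned P f.
Proof.
move=> If [r rP Ir]; exists r => //.
by rewrite -(subrK g f) -addrA; apply: ideal_genD.
Qed.

Lemma spanned0 P : spanned P 0.
Proof. by exists 0; [move=> d; rewrite msupp0 | rewrite subrr; apply: ideal_gen0]. Qed.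

Lemma spannedD P f g : spanned P f -> spanned P g -> spanned P (f + g).
Proof.
case=> [r rP Ir] [t tP It]; exists (r + t); last first.
  by rewrite opprD addrACA; apply: ideal_genD.
by move=> d /msuppD_le; rewrite mem_cat => /orP[/rP|/tP].
Qed.

Lemma spannedZ P c f : spanned P f -> spanned P (c *: f).
Proof.
case=> r rP Ir; exists (c *: r); first by move=> d /msuppZ_le/rP.
by rewrite -scalerBr -mul_mpolyC; apply: ideal_genM.
Qed.

Lemma spanned_sum P (I : Type) (s : seq I) (Q : pred I) (F : I -> Qxy n) :
  (forall i, Q i -> spanned P (F i)) -> spanned P (\sum_(i <- s | Q i) F i).
Proof. by move=> PF; elim/big_ind: _; [exact: spanned0|exact: spannedD|]. Qed.

(** The sum, with 'X_[m] as its term T = S, is the product of the cofactor of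
    [S] in [m] with an elementary symmetric polynomial. *)
Lemma straightening m b (S : {set 'I_n}) : detachable m b S ->
  hook_ideal ('X_[m] + \sum_(T : {set 'I_n} | (#|T| == #|S|) && (T != S))
                          'X_[m - side_mon b S + side_mon b T]).
Proof.
move=> detS; have /and3P[S0 /forall_inP Spos _] := detS.
have leSm : (side_mon b S <= m)%MM.
  by apply/side_mon_le/subsetP => i /Spos; rewrite inE.
rewrite -[X in 'X_[X] + _](submK leSm).
rewrite -(bigD1 S (F := fun T => 'X_[m - side_mon b S + side_mon b T])) //=.
under eq_bigr do rewrite mpolyXD; rewrite -mulr_sumr; apply/ideal_genM.
by apply: hook_ideal_esym; rewrite card_gt0.
Qed.

Definition reduced m : Prop := exists s, reduced_by q m s.

(** Induction on the energy: a detachable set lets straightening apply, and a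
    monomial without any either lies in the ideal or is reduced. *)
Lemma spanned_reduced f : spanned reduced f.
Proof.
rewrite [f]mpolyE; apply: spanned_sum => m _; apply: spannedZ.
have [e] := ubnP `|energy m|%N; elim: e m => // e IHe m; rewrite ltnS => le_me.
have inI : hook_ideal 'X_[m] -> spanned reduced 'X_[m].
  by rewrite -[X in hook_ideal X]subr0 => /spanned_mod; apply; apply: spanned0.
have [/existsP[b /existsP[S detS]]|nodet] :=
    boolP [exists b, exists S, detachable m b S].
  apply: (@spanned_mod _ _ (- \sum_(T : {set 'I_n} | (#|T| == #|S|) && (T != S))
                          'X_[m - side_mon b S + side_mon b T])).
    by rewrite opprK; apply: straightening.
  rewrite -scaleN1r; apply: spannedZ; apply: spanned_sum => T /andP[/eqP cardT neqT].
  apply: IHe; have := energy_exchange detS cardT neqT.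
  have energy_ge0 d : 0 <= energy d by apply: sumr_ge0 => i _; apply: sqr_ge0.
  have := energy_ge0 m; have := energy_ge0 (m - side_mon b S + side_mon b T)%MM.
  by lia.
have [wideX|narrowX] := leqP k #|side_supp m false|.
  exact/inI/(@hook_ideal_wide m false).
have [wideY|narrowY] := ltnP q #|side_supp m true|.
  exact/inI/(@hook_ideal_wide m true).
have [disj|] := boolP [disjoint side_supp m false & side_supp m true]; last first.
  by case/pred0Pn => i /andP[/= xi yi]; apply/inI/(hook_ideal_mixed xi yi).
exists 'X_[m]; last by rewrite subrr; apply: ideal_gen0.
move=> d /mem_msuppXP <-; apply: reduced_exists => //; first by lia.
  by rewrite subKn.
move=> b; move: nodet; rewrite negb_exists => /forallP/(_ b).
by rewrite negb_exists => /forallP.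
Qed.

End Straightening.

(** * The pairing with the hook determinant *)

Section Pairing.
Variable N : nat.
Implicit Types (f g : {mpoly rat[N]}) (m a : 'X_{1..N}).

Lemma pairingE f g :
  pairing f g = \sum_(m <- msupp f) f@_m * (mderivm m g)@_0.
Proof.
by rewrite /pairing /diff_op raddf_sum; apply: eq_bigr => m _; rewrite /= mcoeffZ.
Qed.

Lemma pairing_sumr f (I : Type) (r : seq I) (c : I -> rat)
    (F : I -> {mpoly rat[N]}) :
  pairing f (\sum_(i <- r) c i *: F i) = \sum_(i <- r) c i * pairing f (F i).
Proof.
rewrite pairingE; under [RHS]eq_bigr do rewrite pairingE mulr_sumr.
rewrite exchange_big; apply: eq_bigr => m _.
rewrite !raddf_sum mulr_sumr; apply: eq_bigr => i _.
by rewrite /= linearZ mcoeffZ mulrCA.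
Qed.

(** Differential operators with constant coefficients compose like polynomials
    multiply, so pairing with the derivatives of g amounts to pairing the
    multiples of f with g itself. *)
Lemma pairing_mderivm f g m : pairing f (mderivm m g) = pairing (f * 'X_[m]) g.
Proof.
rewrite !pairingE [RHS](perm_big _ (msuppMX _ _)) [RHS]big_map.
by apply: eq_bigr => d _; rewrite -mderivmDm mcoeffMX.
Qed.

Lemma pairingX f a : pairing f 'X_[a] = f@_a * (\prod_(i < N) (a i)`!)%:R.
Proof.
have coefX m : ('X_[a]^`M[m])@_0 = (m == a)%:R * (\prod_(i < N) (a i)`!)%:R :> rat.
  rewrite mcoeff_mderivm addm0 mcoeffX eq_sym.
  case: eqP => [->|]; last by rewrite mul0rn mul0r.
  by rewrite mul1r; congr _%:R; apply: eq_bigr => i _; rewrite ffactnn.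
rewrite pairingE; under eq_bigr do rewrite coefX mulrA.
rewrite -mulr_suml; congr (_ * _).
have [a_f|/memN_msupp_eq0 fa0] := boolP (a \in msupp f); last first.
  by rewrite fa0 big1 // => m _; case: eqP => [->|]; rewrite ?fa0 ?mulr0 ?mul0r.
rewrite (bigD1_seq a) ?msupp_uniq //= eqxx mulr1 big1 ?addr0 // => m /negPf ->.
by rewrite mulr0.
Qed.

End Pairing.

Section HookDeterminant.
Variables n k : nat.
Hypothesis k_gt0 : (0 < k)%N.
Hypothesis k_le_n : (k <= n)%N.
Local Notation q := (n - k)%N.
Local Notation hook_ideal := (ideal_gen (hook_gen (n := n) k)).
Implicit Types (m d : 'X_{1..n + n}) (f g r : Qxy n) (s t : 'S_n).

Let lt_qn : (q < n)%N. Proof. by lia. Qed.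

(** Listing the columns in the order y^q, ..., y, 1, x, ..., x^(k-1) makes the
    signed exponent of a column its index minus q.  This reverses the first
    q + 1 columns. *)
Definition col_rank_fun (j : 'I_n) : 'I_n :=
  if (j <= q)%N then Ordinal (leq_ltn_trans (leq_subr j q) lt_qn) else j.

Lemma col_rank_inj : injective col_rank_fun.
Proof.
apply: (@inv_inj _ col_rank_fun) => j; apply: ord_inj; rewrite /col_rank_fun.
by case: (leqP j q) => [le_jq|lt_qj]; rewrite ?leq_subr /= ?subKn // leqNgt lt_qj.
Qed.

Definition col_rank : 'S_n := perm col_rank_inj.

Lemma hook_mxE i j :
  hook_mx n k i j = 'X_[U_(side false i) *+ (col_rank j - q) +
                        U_(side true i) *+ (q - col_rank j)].
Proof.
rewrite mxE permE /col_rank_fun mpolyXD -!mpolyXn.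
case: (leqP j q) => [le_jq|lt_qj] /=; rewrite /xvar /yvar /side.
  by rewrite subKn // (_ : (_ - q = 0)%N) ?mul1r //; lia.
by rewrite (_ : (q - j = 0)%N) ?mulr1 //; lia.
Qed.

Lemma hook_mon_sum s : hook_mon q s =
  (\sum_(i < n) (U_(side false i) *+ (s i - q) + U_(side true i) *+ (q - s i)))%MM.
Proof.
apply/mnmP => l; have [b [i ->]] := side_onto l; rewrite hook_monE mnm_sumE.
rewrite (bigD1 i) //= big1 => [|j /negPf neq_ji];
  rewrite mnmDE !mulmnE !mnm1E !side_eq.
  by rewrite eqxx !andbT addn0; case: b; rewrite ?mul1n ?mul0n ?addn0.
by rewrite neq_ji !andbF.
Qed.

Lemma Delta_hook_mon :
  Delta n k = (-1) ^+ col_rank *: \sum_(s : 'S_n) (-1) ^+ s *: 'X_[hook_mon q s].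
Proof.
rewrite /Delta /determinant scaler_sumr.
rewrite [RHS](reindex_inj (mulIg col_rank)) /=.
apply: eq_bigr => s _; rewrite odd_permM scalerA signr_addb mulrCA.
rewrite -expr2 sqrr_sign mulr1 hook_mon_sum -mprodXE -signr_odd.
under eq_bigr do rewrite hook_mxE -permM.
by rewrite signr_odd; case: (odd_perm s);
  rewrite ?expr1 ?expr0 ?scale1r ?mul1r ?scaleN1r ?mulN1r.
Qed.

Definition alt_coef f : rat := \sum_(s : 'S_n) (-1) ^+ s * f@_(hook_mon q s).

(** Independent of [s]: the exponents of [hook_mon q s] are always the same up to
    order. *)
Lemma prod_fact_hook_mon s :
  (\prod_(l < n + n) (hook_mon q s l)`! =
   (\prod_(j < n) (j - q)`!) * \prod_(j < n) (q - j)`!)%N.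
Proof.
rewrite big_split_ord /=; congr (_ * _)%N.
  rewrite [RHS](reindex_inj (@perm_inj _ s)); apply: eq_bigr => i _.
  by rewrite -[lshift _ _]/(side false i) hook_monE.
rewrite [RHS](reindex_inj (@perm_inj _ s)); apply: eq_bigr => i _.
by rewrite -[rshift _ _]/(side true i) hook_monE.
Qed.

Lemma pairing_Delta_eq0 f : (pairing f (Delta n k) == 0) = (alt_coef f == 0).
Proof.
set c : rat := (-1) ^+ col_rank.
pose K := ((\prod_(j < n) (j - q)`!) * \prod_(j < n) (q - j)`!)%N.
have -> : pairing f (Delta n k) = c * K%:R * alt_coef f.
  rewrite Delta_hook_mon scaler_sumr; under eq_bigr do rewrite scalerA.
  rewrite pairing_sumr mulr_sumr; apply: eq_bigr => s _.
  by rewrite pairingX prod_fact_hook_mon [f@_ _ * _]mulrC mulrACA.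
have K_neq0 : K%:R != 0 :> rat.
  by rewrite pnatr_eq0 -lt0n muln_gt0 !prodn_gt0 // => j; rewrite fact_gt0.
by rewrite !mulf_eq0 signr_eq0 (negPf K_neq0).
Qed.

Lemma alt_coefD f g : alt_coef (f + g) = alt_coef f + alt_coef g.
Proof.
by rewrite /alt_coef -big_split; apply: eq_bigr => s _; rewrite mcoeffD mulrDr.
Qed.

Lemma alt_coefZ c f : alt_coef (c *: f) = c * alt_coef f.
Proof.
by rewrite /alt_coef mulr_sumr; apply: eq_bigr => s _; rewrite mcoeffZ mulrCA.
Qed.

Lemma alt_coef_sum (I : Type) (r : seq I) (P : pred I) (F : I -> Qxy n) :
  alt_coef (\sum_(i <- r | P i) F i) = \sum_(i <- r | P i) alt_coef (F i).
Proof.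
apply: (big_morph alt_coef alt_coefD).
by rewrite /alt_coef big1 // => s _; rewrite mcoeff0 mulr0.
Qed.

Lemma J_mu_alt_coef f :
  J_mu k f <-> forall m, alt_coef (f * 'X_[m]) = 0.
Proof.
split=> [Jf m|alt0 g [r Dr ->]].
  apply/eqP; rewrite -pairing_Delta_eq0 -pairing_mderivm; apply/eqP/Jf.
  exists [:: (1, mderivm m (Delta n k))]; last by rewrite big_seq1 scale1r.
  by move=> p; rewrite inE => /eqP ->; exists m.
rewrite pairing_sumr big_seq big1 // => p /Dr[m ->].
rewrite pairing_mderivm.
by have /eqP := alt0 m; rewrite -pairing_Delta_eq0 => /eqP ->; rewrite mulr0.
Qed.

Lemma alt_coefMl f g : (forall m, alt_coef (g * 'X_[m]) = 0) -> alt_coef (f * g) = 0.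
Proof.
move=> alt0; rewrite [f]mpolyE mulr_suml alt_coef_sum big1 // => m _.
by rewrite -scalerAl alt_coefZ mulrC [_ * g]mulrC alt0 mul0r.
Qed.

(** * The generators annihilate the hook determinant *)

Lemma alt_coefX m :
  alt_coef 'X_[m] = \sum_(s : 'S_n) (-1) ^+ s * (m == hook_mon q s)%:R.
Proof. by apply: eq_bigr => s _; rewrite mcoeffX. Qed.

Lemma alt_coefX_eq0 m : (forall s, m != hook_mon q s) -> alt_coef 'X_[m] = 0.
Proof.
move=> neq_m; rewrite alt_coefX big1 // => s _.
by rewrite (negPf (neq_m s)) mulr0.
Qed.

Lemma card_supp_hook_mon s b :
  (#|side_supp (hook_mon q s) b| < if b then q.+1 else k)%N.
Proof.
case: b.
  have -> : side_supp (hook_mon q s) true = ~: [set i | (q <= s i)%N].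
    by apply/setP => i; rewrite !inE hook_monE; lia.
  by rewrite cardsCs setCK card_ord card_perm_geq subKn // ltnW.
have -> : side_supp (hook_mon q s) false = [set i | (q.+1 <= s i)%N].
  by apply/setP => i; rewrite !inE hook_monE; lia.
by rewrite card_perm_geq; lia.
Qed.

Lemma alt_coef_side_mon b (A : {set 'I_n}) m : #|A| = (if b then q.+1 else k) ->
  alt_coef 'X_[side_mon b A + m] = 0.
Proof.
move=> cardA; apply: alt_coefX_eq0 => s; apply/eqP => eq_s.
have := card_supp_hook_mon s b; rewrite -cardA ltnNge => /negP; apply.
apply: subset_leq_card; apply/subsetP => i iA.
by rewrite inE -eq_s mnmDE side_monE eqxx iA.
Qed.

Lemma alt_coef_mixed (i : 'I_n) m :
  alt_coef 'X_[U_(side false i) + U_(side true i) + m] = 0.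
Proof.
apply: alt_coefX_eq0 => s; apply/eqP => eq_s.
have eq_side b : (0 < hook_mon q s (side b i))%N.
  by rewrite -eq_s !mnmDE !mnm1E !side_eq eqxx !andbT; case: b.
by have := eq_side true; have := eq_side false; rewrite !hook_monE; lia.
Qed.

Definition swap_mon (t : 'S_n) m : 'X_{1..n + n} :=
  [multinom match fintype.split l with
            | inl i => m (side false (t i))
            | inr i => m (side true (t i))
            end | l < n + n].

Lemma swap_monE t m b i : swap_mon t m (side b i) = m (side b (t i)).
Proof.
by rewrite mnmE; case: b; rewrite /side ?(unsplitK (inl i)) ?(unsplitK (inr i)).
Qed.

Lemma side_mnmP m d : (forall b i, m (side b i) = d (side b i)) -> m = d.
Proof. by move=> eq_md; apply/mnmP => l; have [b [i ->]] := side_onto l. Qed.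

Lemma alt_coef_swap (i j : 'I_n) m : i != j ->
  alt_coef 'X_[swap_mon (tperm i j) m] = - alt_coef 'X_[m].
Proof.
move=> neq_ij; rewrite !alt_coefX -sumrN (reindex_inj (mulgI (tperm i j))) /=.
apply: eq_bigr => s _; rewrite odd_permM odd_tperm neq_ij signr_addb expr1 mulN1r mulNr.
congr (- (_ * _%:R)); congr nat_of_bool.
have -> : hook_mon q (tperm i j * s) = swap_mon (tperm i j) (hook_mon q s).
  by apply: side_mnmP => b l; rewrite swap_monE !hook_monE permM.
apply/eqP/eqP => [eq_swap|->//]; apply: side_mnmP => b l.
have := congr1 (fun d : 'X_{1..n + n} => d (side b (tperm i j l))) eq_swap.
by rewrite !swap_monE tpermK.
Qed.

Definition side_emb b (a : 'X_{1..n}) : 'X_{1..n + n} :=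
  (\sum_(i < n) U_(side b i) *+ a i)%MM.

Lemma side_embE b a b' i : side_emb b a (side b' i) = if b == b' then a i else 0%N.
Proof.
rewrite /side_emb mnm_sumE (bigD1 i) //= big1 => [|j /negPf neq_ji].
  by rewrite mulmnE mnm1E side_eq eqxx andbT addn0; case: eqP; rewrite ?mul1n.
by rewrite mulmnE mnm1E side_eq neq_ji andbF.
Qed.

Lemma comp_side (p : {mpoly rat[n]}) b :
  p \mPo [tuple (if b then yvar i else xvar i) | i < n] =
  \sum_(a <- msupp p) p@_a *: 'X_[side_emb b a].
Proof.
rewrite comp_mpolyE; apply: eq_bigr => a _; congr (_ *: _).
rewrite /side_emb -mprodXnE; apply: eq_bigr => i _.
by rewrite tnth_mktuple; case: b.
Qed.

(** On each side the nonzero exponents of [hook_mon q s] form an initial segment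
    of the positive integers, each attained once, and one position carries no
    variable at all. *)
Lemma hook_mon_below s b i u : (u <= hook_mon q s (side b i))%N ->
  exists j, hook_mon q s (side b j) = u /\ hook_mon q s (side (~~ b) j) = 0%N.
Proof.
rewrite hook_monE => le_u; have lt_si := ltn_ord (s i).
have lt_vn : ((if b then q - u else q + u) < n)%N by case: b le_u; lia.
exists ((s^-1)%g (Ordinal lt_vn)).
by rewrite !hook_monE permKV /=; case: b le_u lt_vn => /=; lia.
Qed.

Lemma hook_mon_disjoint s b i :
  (0 < hook_mon q s (side b i))%N -> hook_mon q s (side (~~ b) i) = 0%N.
Proof. by rewrite !hook_monE; case: b => /=; lia. Qed.

(** The exponents of [hook_mon q s] on side [b] are the smallest possible ones
    for distinct positions, so there is no room for [a].  By induction on the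
    exponent v of [hook_mon q s] at i: if a i > 0, the exponent of [m] at i is
    smaller than v; it is the exponent of [hook_mon q s] at some j, where the
    induction gives a j = 0, so that [m] has the same exponents at i and j. *)
Lemma side_emb_hook_mon b (a : 'X_{1..n}) m s :
  (forall i j, (forall b', m (side b' i) = m (side b' j)) -> i = j) ->
  (side_emb b a + m)%MM = hook_mon q s -> a = 0%MM.
Proof.
move=> m_inj eq_s; apply/mnmP => i; rewrite mnm0E.
have eq_b l : (a l + m (side b l))%N = hook_mon q s (side b l).
  by rewrite -eq_s mnmDE side_embE eqxx.
have eq_nb l : m (side (~~ b) l) = hook_mon q s (side (~~ b) l).
  by rewrite -eq_s mnmDE side_embE; case: b {eq_b eq_s}.
have [v] := ubnP (hook_mon q s (side b i)); elim: v i => // v IHv i.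
rewrite ltnS => le_v; apply/eqP; rewrite -leqn0 leqNgt; apply/negP => a_gt0.
have [|j [jb jnb]] := @hook_mon_below s b i (m (side b i)).
  by rewrite -eq_b leq_addl.
have aj0 : a j = 0%N by apply: IHv; have := eq_b i; lia.
have eq_ij : i = j.
  apply: m_inj => b'; have := eq_b j; rewrite aj0 add0n => mj.
  have [->|] := eqVneq b' b; first by rewrite mj jb.
  move=> neq_b; have -> : b' = ~~ b by move: neq_b; clear; case: b b' => -[].
  by rewrite !eq_nb jnb hook_mon_disjoint // -eq_b addn_gt0 a_gt0.
by move: a_gt0; rewrite eq_ij aj0.
Qed.

(** If [m] has equal exponents at two positions, the transposition of these
    positions fixes p * 'X_[m] but changes the sign of [alt_coef].  Otherwise
    [side_emb_hook_mon] leaves only the constant term of [p]. *)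
Lemma alt_coef_sym (p : {mpoly rat[n]}) b m : p \is symmetric -> p@_0 = 0 ->
  alt_coef ((p \mPo [tuple (if b then yvar i else xvar i) | i < n]) * 'X_[m]) = 0.
Proof.
move=> p_sym p0.
pose f := p \mPo [tuple (if b then yvar i else xvar i) | i < n].
have altE : alt_coef (f * 'X_[m]) =
    \sum_(a <- msupp p) p@_a * alt_coef 'X_[side_emb b a + m].
  rewrite /f comp_side mulr_suml alt_coef_sum; apply: eq_bigr => a _.
  by rewrite -scalerAl alt_coefZ -mpolyXD.
have [/existsP[i /existsP[j /andP[neq_ij /forallP eq_ij]]]|m_inj] :=
    boolP [exists i, exists j,
      (i != j) && [forall b', m (side b' i) == m (side b' j)]].
  pose t := tperm i j; pose h (a : 'X_{1..n}) := [multinom a (t l) | l < n].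
  have hK : involutive h by move=> a; apply/mnmP => l; rewrite !mnmE tpermK.
  have permE : perm_eq (msupp p) (map h (msupp p)).
    have h_inj : injective h := inv_inj hK.
    apply: uniq_perm; rewrite ?(map_inj_uniq h_inj) ?msupp_uniq //.
    by move=> a; rewrite -[a in RHS]hK (mem_map h_inj) issym_msupp.
  rewrite -/f; apply/eqP; rewrite -eqNr eq_sym; apply/eqP.
  rewrite {1}altE (perm_big _ permE) [LHS]big_map altE -sumrN; apply: eq_bigr => a _.
  rewrite msym_coeff // -mulrN -(alt_coef_swap _ neq_ij); congr (_ * alt_coef 'X_[_]).
  apply: side_mnmP => b' l; rewrite swap_monE !mnmDE !side_embE mnmE; congr (_ + _)%N.
  have /eqP eq_b' := eq_ij b'.
  by case: tpermP => [->|->|].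
rewrite -/f altE big_seq big1 // => a a_p; rewrite alt_coefX_eq0 ?mulr0 // => s.
apply/eqP => eq_s; suff a0 : a = 0%MM by move: a_p; rewrite mcoeff_msupp a0 p0 eqxx.
apply: side_emb_hook_mon eq_s => i j eq_ij; apply/eqP.
apply: contraNT m_inj => neq_ij; apply/existsP; exists i; apply/existsP; exists j.
by rewrite neq_ij; apply/forallP => b'; apply/eqP.
Qed.

Lemma hook_ideal_J_mu f : hook_ideal f -> J_mu k f.
Proof.
case=> r Gr ->; apply/J_mu_alt_coef => m; rewrite mulr_suml alt_coef_sum big_seq.
apply: big1 => p /Gr Gp; rewrite -mulrA [p.2 * _]mulrC mulrA.
apply: alt_coefMl => d; case: Gp => [g|g|A cardA|A cardA|i].
- by case=> u [u_sym u0 ->]; apply: (@alt_coef_sym u false).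
- by case=> u [u_sym u0 ->]; apply: (@alt_coef_sym u true).
- by rewrite -(side_monX false) -mpolyXD (@alt_coef_side_mon false).
- by rewrite -(side_monX true) -mpolyXD (@alt_coef_side_mon true) // cardA addn1.
- by rewrite -!mpolyXD alt_coef_mixed.
Qed.

(** * Independence of the reduced monomials *)

(** Multiplying by the cofactor of a term of maximal energy and taking [alt_coef]
    isolates the coefficient of that term, by [energy_hook_complement]. *)
Lemma reduced_J_mu_eq0 r : (forall d, d \in msupp r -> exists s, reduced_by q d s) ->
  J_mu k r -> r = 0.
Proof.
move=> red_r /J_mu_alt_coef alt0; apply/eqP; apply: contraT.
rewrite -msupp_eq0 => r_neq0.
have [m m_r m_max] :
    exists2 m, m \in msupp r & forall d, d \in msupp r -> energy d <= energy m.
  elim: (msupp r) r_neq0 {red_r} => // m0 [|m1 l] IHl _.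
    by exists m0 => [|d]; rewrite mem_seq1 // => /eqP ->.
  have [//|m m_l m_max] := IHl; have [le_m|/ltW le_m] := leP (energy m0) (energy m).
    by exists m => [|d]; rewrite inE ?m_l ?orbT // => /predU1P[->//|/m_max].
  exists m0 => [|d]; rewrite inE ?eqxx // => /predU1P[->//|/m_max].
  by move/le_trans; apply.
have [s red_m] := red_r m m_r; have := alt0 (hook_mon q s - m)%MM.
have coef_s : (r * 'X_[hook_mon q s - m])@_(hook_mon q s) = r@_m.
  by rewrite -[X in _@_X](submK (proj1 red_m)) mcoeffMX.
rewrite /alt_coef (bigD1 s) //= coef_s.
rewrite big1 ?addr0 => [|t neq_ts].
  move/eqP; rewrite mulf_eq0 signr_eq0 => /eqP rm0.
  by move: m_r; rewrite mcoeff_msupp rm0 eqxx.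
apply/eqP; rewrite mulf_eq0 mcoeff_eq0 (perm_mem (msuppMX _ _)).
apply/orP; right; apply/mapP => -[d d_r eq_t].
have := energy_hook_complement red_m (esym (etrans eq_t (addmC _ _))) neq_ts.
by rewrite ltNge m_max.
Qed.

End HookDeterminant.

Theorem theorem1p4 (n k : nat) (k_gt0 : (1 <= k)%N) (k_le_n : (k <= n)%N)
    (f : Qxy n) :
  J_mu k f <-> ideal_gen (hook_gen (n := n) k) f.
Proof.
split; last exact: hook_ideal_J_mu.
move=> Jf; have [r red_r Ifr] := spanned_reduced k_gt0 k_le_n f.
have Jr : J_mu k r.
  move/J_mu_alt_coef: (hook_ideal_J_mu k_gt0 k_le_n Ifr); move/J_mu_alt_coef: Jf.
  move=> Jf Jfr; apply/J_mu_alt_coef => // m.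
  have -> : r = f + -1 *: (f - r) by rewrite scaleN1r opprB addrC subrK.
  by rewrite mulrDl alt_coefD Jf // -scalerAl alt_coefZ Jfr // mulr0 addr0.
by rewrite (reduced_J_mu_eq0 k_gt0 k_le_n red_r Jr) subr0 in Ifr.
Qed.
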